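(* Let $\psi_m=\nu(\phi_p,\delta_q)\psi_q+\lambda(\phi_p)\psi_p$, with $\nu\in R[\xi_p,\xi_q]$ and $\lambda\in R[\xi_p]$, be a non-degenerate $\{\delta_p,\delta_q\}$-character of $\mathbb G_m$ over $R$, and let $u\in\mathcal U_\pm=\{u\in R[[q^{\pm1}]]^\times:\psi_mu=0\}$. Then: 1) The series $\overline{\psi_qu}\in k[[q^{\pm1}]]$ (reduction mod $p$ of $\psi_qu$) is integral over $k[q^{\pm1}]$, and the field extension $k(q)\subset k(q,\overline{\psi_qu})$ is Abelian with Galois group killed by $p$. 2) If the characteristic polynomial of $\psi_m$ is unmixed and the set $\mathcal K_\pm$ of positive (resp. negative) characteristic integers is short, then $u$ is transcendental over $K(q)$. (Signs are taken consistently; $k[q^{\pm1}]$ means $k[q]$, resp. $k[q^{-1}]$.)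
   Context: $p\ne 2$ is a prime, $R$ is the completion of the maximal unramified extension of $\mathbb Z_p$, $K=R[1/p]$, $k=R/pR$, $\phi:R\to R$ the unique automorphism lifting the $p$-power Frobenius on $k$. On $R[[q^{\pm1}]]$: $\phi_p(\sum a_nq^n)=\sum\phi(a_n)q^{pn}$, $\delta_pu=\frac{\phi_p(u)-u^p}{p}$, $\delta_q(\sum a_nq^n)=\sum na_nq^n$. For invertible $u$: $\psi_q(u)=\frac{\delta_qu}{u}$, $\psi_p(u)=\frac1p\log\frac{\phi_p(u)}{u^p}=\sum_{n\ge1}(-1)^{n-1}\frac{p^{n-1}}{n}\left(\frac{\delta_pu}{u^p}\right)^n$. For a polynomial $\nu=\sum\nu_{ij}\xi_p^i\xi_q^j$, $\nu(\phi_p,\delta_q)=\sum\nu_{ij}\phi_p^i\delta_q^j$. The characteristic polynomial of $\psi_m$ is $$\mu(\xi_p,\xi_q)=\nu(p\xi_p,\xi_q)\xi_q+\lambda(p\xi_p)(\xi_p-1)=\sum\mu_{ij}\xi_p^i\xi_q^j.$$ $\psi_m$ is non-degenerate if $\mu(0,0)\in R^\times$ (equivalently $\lambda(0)\in R^\times$). A characteristic integer is $\kappa\in\mathbb Z$ with $\mu(0,\kappa)=0$. $\mu$ is unmixed if, with $\bar\mu_{ij}$ the reductions mod $p$ of its coefficients, $\bar\mu_{ij}=0$ whenever $ij\neq0$, and $\bar\mu_{i0}\ne0$ for some $i\neq0$. A set $S$ of positive integers is short if $\max S/\min S<p/2$; a set $S$ of negative integers is short if $-S$ is short.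
   Formalization: In part 2, u is additionally assumed not to be a constant (not an element of R): as worded the claim fails, since u = 1 always lies in U_± and is algebraic over K(q), e.g. for ν = λ = 1. *)

(* Defs.v *)
From HB Require Import structures.
From mathcomp Require Import all_boot all_order all_fingroup all_algebra all_field.
From mathcomp Require Import boolp classical_sets.

Set Implicit Arguments.
Unset Strict Implicit.
Unset Printing Implicit Defensive.

Import GRing.Theory Num.Theory.
Local Open Scope ring_scope.

Notation "x %:F" := (@FracField.tofrac _ x) : ring_scope.

(* Formal power series in one variable x.  Both R[[q]] and R[[q^-1]] are      *)
(* represented by [fps R], with x = q, resp. x = q^-1; the operators below    *)
(* that depend on the choice take a boolean s, with x = q^((-1)^s).           *)
Record fps (R : Type) := Fps { fps_coef :> nat -> R }.

Lemma fpsP (R : Type) (f g : fps R) : f =1 g -> f = g.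
Proof. by case: f g => [f] [g] /= /funext ->. Qed.

HB.instance Definition _ (R : Type) := gen_eqMixin (fps R).
HB.instance Definition _ (R : Type) := gen_choiceMixin (fps R).

Section FpsRing.
Variable R : comNzRingType.
Implicit Types f g h : fps R.

Definition fpsC (c : R) : fps R := Fps (fun n => if n is 0 then c else 0).
Definition fps_add f g := Fps (fun n => f n + g n).
Definition fps_opp f := Fps (fun n => - f n).
Definition fps_mul f g := Fps (fun n => \sum_(i < n.+1) f i * g (n - i)%N).
Definition fps_scale (c : R) f := Fps (fun n => c * f n).

Fact fps_addA : associative fps_add.
Proof. by move=> f g h; apply: fpsP => n /=; rewrite addrA. Qed.
Fact fps_addC : commutative fps_add.
Proof. by move=> f g; apply: fpsP => n /=; rewrite addrC. Qed.
Fact fps_add0 : left_id (fpsC 0) fps_add.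
Proof. by move=> f; apply: fpsP => [[|n]] /=; rewrite add0r. Qed.
Fact fps_addN : left_inverse (fpsC 0) fps_opp fps_add.
Proof. by move=> f; apply: fpsP => [[|n]] /=; rewrite addNr. Qed.

HB.instance Definition _ := GRing.isZmodule.Build (fps R)
  fps_addA fps_addC fps_add0 fps_addN.

Lemma fps_mul_coefM f g (P Q : {poly R}) n :
    (forall i, (i <= n)%N -> P`_i = f i) ->
    (forall i, (i <= n)%N -> Q`_i = g i) ->
  fps_mul f g n = (P * Q)`_n.
Proof.
move=> eqP eqQ; rewrite coefM /=; apply: eq_bigr => i _.
by rewrite eqP ?eqQ ?leq_subr // -ltnS.
Qed.

Definition fps_trunc n f : {poly R} := \poly_(i < n.+1) f i.

Lemma coef_trunc n f i : (i <= n)%N -> (fps_trunc n f)`_i = f i.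
Proof. by move=> le_in; rewrite coef_poly ltnS le_in. Qed.

Lemma fps_mul_trunc f g n m : (m <= n)%N ->
  fps_mul f g m = (fps_trunc n f * fps_trunc n g)`_m.
Proof.
by move=> le_mn; apply: fps_mul_coefM => i le_im;
   rewrite coef_trunc // (leq_trans le_im).
Qed.

Fact fps_mulA : associative fps_mul.
Proof.
move=> f g h; apply: fpsP => n.
rewrite (@fps_mul_coefM _ _ (fps_trunc n f) (fps_trunc n g * fps_trunc n h)).
- rewrite (@fps_mul_coefM _ _ (fps_trunc n f * fps_trunc n g) (fps_trunc n h)).
  + by rewrite mulrA.
  + by move=> i le_in; rewrite -fps_mul_trunc.
  + by move=> i; apply: coef_trunc.
- by move=> i; apply: coef_trunc.
- by move=> i le_in; rewrite -fps_mul_trunc.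
Qed.

Fact fps_mulC : commutative fps_mul.
Proof.
by move=> f g; apply: fpsP => n; rewrite !(fps_mul_trunc _ _ (leqnn n)) mulrC.
Qed.

Fact fps_mul1 : left_id (fpsC 1) fps_mul.
Proof.
move=> f; apply: fpsP => n.
rewrite (@fps_mul_coefM _ _ 1 (fps_trunc n f)) ?mul1r ?coef_trunc //.
- by move=> [|i] _; rewrite coef1.
- by move=> i; apply: coef_trunc.
Qed.

Fact fps_mulDl : left_distributive fps_mul fps_add.
Proof.
move=> f g h; apply: fpsP => n /=; rewrite -big_split /=.
by apply: eq_bigr => i _; rewrite mulrDl.
Qed.

Fact fps_1_neq0 : fpsC 1 != 0 :> fps R.
Proof.
apply/eqP => /(congr1 (fun f : fps R => f 0%N)) /= /eqP.
by rewrite oner_eq0.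
Qed.

HB.instance Definition _ := GRing.Zmodule_isComNzRing.Build (fps R)
  fps_mulA fps_mulC fps_mul1 fps_mulDl fps_1_neq0.

Fact fps_scaleA a b f : fps_scale a (fps_scale b f) = fps_scale (a * b) f.
Proof. by apply: fpsP => n /=; rewrite mulrA. Qed.
Fact fps_scale1 : left_id 1 fps_scale.
Proof. by move=> f; apply: fpsP => n /=; rewrite mul1r. Qed.
Fact fps_scaleDr : right_distributive fps_scale +%R.
Proof. by move=> c f g; apply: fpsP => n /=; rewrite mulrDr. Qed.
Fact fps_scaleDl f : {morph fps_scale^~ f : a b / a + b}.
Proof. by move=> a b; apply: fpsP => n /=; rewrite mulrDl. Qed.

HB.instance Definition _ := GRing.Zmodule_isLmodule.Build R (fps R)
  fps_scaleA fps_scale1 fps_scaleDr fps_scaleDl.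

Definition fps_unit : pred (fps R) := fun f => `[< exists g, g * f = 1 >].
Definition fps_inv f : fps R :=
  if f \in fps_unit then xget 0 [set g | g * f = 1]%classic else f.

Fact fps_mulVf : {in fps_unit, left_inverse 1 fps_inv *%R}.
Proof.
move=> f Uf; rewrite /fps_inv Uf; case: xgetP => [g _ //|no_inv].
by move: Uf => /asboolP[g /no_inv].
Qed.
Fact fps_unitPl f g : g * f = 1 -> f \in fps_unit.
Proof. by move=> gf1; apply/asboolP; exists g. Qed.
Fact fps_inv_out : {in [predC fps_unit], fps_inv =1 id}.
Proof. by move=> f /negPf nUf; rewrite /fps_inv nUf. Qed.

HB.instance Definition _ := GRing.ComNzRing_hasMulInverse.Build (fps R)
  fps_mulVf fps_unitPl fps_inv_out.

Definition poly_fps (P : {poly R}) : fps R := Fps (fun i => P`_i).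

Fact poly_fps_zmod : zmod_morphism poly_fps.
Proof. by move=> P Q; apply: fpsP => n /=; rewrite coefB. Qed.
Fact poly_fps_monoid : monoid_morphism poly_fps.
Proof.
split=> [|P Q]; apply: fpsP => n; first by case: n => [|n]; rewrite /= coef1.
by rewrite /= coefM.
Qed.
HB.instance Definition _ := GRing.isZmodMorphism.Build {poly R} (fps R)
  poly_fps poly_fps_zmod.
HB.instance Definition _ := GRing.isMonoidMorphism.Build {poly R} (fps R)
  poly_fps poly_fps_monoid.

Lemma poly_fps_inj : injective poly_fps.
Proof. by move=> P Q eqPQ; apply/polyP => i; have := congr1 (fun f : fps R => f i) eqPQ. Qed.

End FpsRing.

Section FpsDomain.
Variable R : idomainType.

Fact fps_mulf_eq0 (f g : fps R) : f * g = 0 -> (f == 0) || (g == 0).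
Proof.
have low (h : fps R) : h != 0 ->
    exists m, h m != 0 /\ forall i, (i < m)%N -> h i = 0.
  move=> nz_h; have ex_h : exists m, h m != 0.
    apply: contrapT => h0; case/eqP: nz_h; apply: fpsP => m.
    have -> : (0 : fps R) m = 0 by case: m.
    by apply: contrapT => /eqP hm; apply: h0; exists m.
  exists (ex_minn ex_h); case: ex_minnP => m hm min_m; split=> // i lt_im.
  by apply/eqP; apply: contraTT lt_im => /min_m; rewrite -leqNgt.
move=> fg0; apply: contrapT => /negP; rewrite negb_or => /andP[/low[a [fa f0]]].
move=> /low[b [gb g0]].
have := congr1 (fun h : fps R => h (a + b)%N) fg0.
have -> : (0 : fps R) (a + b)%N = 0 by case: (a + b)%N.
have lt_a : (a < (a + b).+1)%N by rewrite ltnS leq_addr.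
rewrite [LHS](bigD1 (Ordinal lt_a)) //= addKn big1 => [|i ne_ia].
  by rewrite addr0 => /eqP; rewrite mulf_eq0 (negPf fa) (negPf gb).
case: (ltngtP i a) => [/f0->|lt_ai|eq_ia]; first by rewrite mul0r.
  by rewrite (g0 (a + b - i)%N) ?mulr0 // ltn_subLR ?ltn_add2r // -ltnS.
by case/eqP: ne_ia; apply: val_inj.
Qed.

HB.instance Definition _ := GRing.ComUnitRing_isIntegral.Build (fps R)
  fps_mulf_eq0.

End FpsDomain.

Definition map_fps (R S : Type) (h : R -> S) (f : fps R) : fps S :=
  Fps (fun n => h (f n)).


Lemma frac_repr (A : idomainType) (x : {fraction A}) :
  x = (\n_(generic_quotient.repr x))%:F / (\d_(generic_quotient.repr x))%:F.
Proof.
have nz_d : (\d_(generic_quotient.repr x))%:F != 0 :> {fraction A}.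
  by rewrite tofrac_eq0 denom_ratioP.
apply: (mulIf nz_d); rewrite divfK // -[x in LHS](@reprK _ {fraction A}).
unlock FracField.tofrac; rewrite -[LHS]FracField.pi_mul.
apply/eqmodP; rewrite /= FracField.equivfE.
rewrite /FracField.mulf !numden_Ratio ?oner_eq0 ?mulr1 ?denom_ratioP //.
by rewrite reprK mulrC.
Qed.

Section FracMap.
Variables (A B : idomainType) (h : {rmorphism A -> B}).

(* The extension of h to the fraction fields; meaningful for h injective. *)
Definition frac_map (x : {fraction A}) : {fraction B} :=
  (h \n_(generic_quotient.repr x))%:F / (h \d_(generic_quotient.repr x))%:F.

Hypothesis h_inj : injective h.

Let nz_h (a : A) : a != 0 -> (h a)%:F != 0 :> {fraction B}.
Proof. by rewrite tofrac_eq0 raddf_eq0. Qed.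

Lemma frac_mapE (n d : A) : d != 0 ->
  frac_map (n%:F / d%:F) = (h n)%:F / (h d)%:F.
Proof.
move=> nz_d; rewrite /frac_map; set r := generic_quotient.repr _.
have := frac_repr (n%:F / d%:F); rewrite -/r => /eqP.
rewrite eqr_div ?tofrac_eq0 ?denom_ratioP // -!rmorphM tofrac_eq => /eqP eq_nd.
apply/eqP; rewrite eqr_div ?nz_h ?denom_ratioP //.
by rewrite -!rmorphM tofrac_eq eq_nd.
Qed.

Fact frac_map_zmod : zmod_morphism frac_map.
Proof.
move=> x y; rewrite [x]frac_repr [y]frac_repr.
move: (generic_quotient.repr x) (generic_quotient.repr y) => r s.
have [nz_r nz_s] := (denom_ratioP r, denom_ratioP s).
rewrite -mulNr addf_div ?tofrac_eq0 // -rmorphN -!rmorphM -rmorphD.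
rewrite !frac_mapE ?mulf_neq0 // -mulNr addf_div ?nz_h //.
by rewrite rmorphD !rmorphM rmorphN !(rmorphM, rmorphD, rmorphN).
Qed.

Fact frac_map_monoid : monoid_morphism frac_map.
Proof.
split=> [|x y].
  by rewrite -[1]divr1 -[1](rmorph1 (@FracField.tofrac A)) frac_mapE ?oner_eq0 //
             rmorph1 divff // tofrac_eq0 oner_eq0.
rewrite [x]frac_repr [y]frac_repr.
move: (generic_quotient.repr x) (generic_quotient.repr y) => r s.
have [nz_r nz_s] := (denom_ratioP r, denom_ratioP s).
by rewrite mulf_div -!rmorphM !frac_mapE ?mulf_neq0 // mulf_div !rmorphM.
Qed.

End FracMap.

(* For a field F, the inclusion of F(q) = F(x) into Frac F[[x]]. *)
Definition ratfun_fps (F : fieldType) :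
    {fraction {poly F}} -> {fraction (fps F)} :=
  frac_map (@poly_fps F).

HB.instance Definition _ (F : fieldType) :=
  GRing.isZmodMorphism.Build _ _ (@ratfun_fps F)
    (frac_map_zmod (@poly_fps_inj F)).
HB.instance Definition _ (F : fieldType) :=
  GRing.isMonoidMorphism.Build _ _ (@ratfun_fps F)
    (frac_map_monoid (@poly_fps_inj F)).

Lemma ratfun_fpsE (F : fieldType) (P : {poly F}) :
  ratfun_fps P%:F = (poly_fps P)%:F.
Proof.
rewrite -[P%:F]divr1 -[1](rmorph1 (@FracField.tofrac {poly F})).
by rewrite /ratfun_fps frac_mapE ?oner_eq0 ?rmorph1 ?divr1 //; exact: poly_fps_inj.
Qed.

Section BaseRing.
Variable p : nat.

Definition pdvd (A : nzRingType) (n : nat) (x : A) :=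
  exists y, x = p%:R ^+ n * y.

Definition padic_lim (A : nzRingType) (x : nat -> A) (l : A) :=
  forall n, exists N, forall m, (N <= m)%N -> pdvd n (x m - l).

(* i exhibits B as the p-adic completion of A: B is p-adically separated and  *)
(* complete, and A/p^n -> B/p^n is bijective for all n.                       *)
Definition is_padic_completion (A B : nzRingType) (i : A -> B) :=
  [/\ forall b : B, (forall n, pdvd n b) -> b = 0,
      forall x : nat -> B, (forall n, pdvd n (x n.+1 - x n)) ->
        exists l, padic_lim x l,
      forall n a, pdvd n (i a) -> pdvd n a
    & forall n b, exists a, pdvd n (b - i a)].

Definition is_Zp (Zp : idomainType) :=
  is_padic_completion (fun m : int => m%:~R : Zp).

(* O is the valuation ring of an algebraic extension of Frac Zp in which p    *)
(* is still a uniformizer; residue extensions of F_p are always separable.    *)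
Definition unramified_over (Zp O : idomainType) (j : Zp -> O) :=
  [/\ injective j, forall x, integralOver j x
    & forall x : O, (x \is a GRing.unit) <-> ~ pdvd 1 x].

Definition is_max_unramified (Zp O : idomainType) (j : {rmorphism Zp -> O}) :=
  unramified_over j /\
  forall (O' : idomainType) (f : {rmorphism O -> O'}),
    unramified_over (f \o j) -> bijective f.

Definition is_completed_max_unramified (R : idomainType) :=
  exists (Zp O : idomainType) (j : {rmorphism Zp -> O})
         (i : {rmorphism O -> R}),
    [/\ is_Zp Zp, is_max_unramified j & is_padic_completion i].

Definition is_residue_field (R : idomainType) (k : fieldType)
    (red : {rmorphism R -> k}) :=
  (forall c, exists x, red x = c) /\ (forall x, red x = 0 <-> pdvd 1 x).

Definition is_localization_at_p (R : idomainType) (K : fieldType)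
    (iota : {rmorphism R -> K}) :=
  [/\ injective iota, p%:R != 0 :> K
    & forall c : K, exists x n, c = iota x / p%:R ^+ n].

Definition is_frobenius_lift (R : idomainType) (k : fieldType)
    (red : {rmorphism R -> k}) (phi : {rmorphism R -> R}) :=
  bijective phi /\ (forall x, red (phi x) = red x ^+ p).

End BaseRing.

Section Operators.
Variables (p : nat) (s : bool) (R : idomainType) (phi : {rmorphism R -> R}).
Implicit Types u f : fps R.

Definition phi_p f : fps R :=
  Fps (fun n => if (p %| n)%N then phi (f (n %/ p)%N) else 0).

(* The coefficient of x^n = q^((-1)^s n) is multiplied by (-1)^s n. *)
Definition delta_q f : fps R := Fps (fun n => (-1) ^+ s * n%:R * f n).

Definition delta_p u : fps R :=
  xget 0 [set v | p%:R * v = phi_p u - u ^+ p]%classic.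

Definition psi_q u : fps R := delta_q u / u.

(* The element (-1)^(n-1) p^(n-1) / n of R: the p-part p^v of n is cancelled  *)
(* against p^(n-1), and the prime-to-p part of n is a unit of R.              *)
Definition log_coef (n : nat) : R :=
  (-1) ^+ n.-1 * p%:R ^+ (n.-1 - logn p n) / (n`_p^')%:R.

Lemma log_coefE n : prime p -> (0 < n)%N ->
    (n`_p^')%:R \is a @GRing.unit R ->
  n%:R * log_coef n = (-1) ^+ n.-1 * p%:R ^+ n.-1.
Proof.
move=> p_pr n_gt0 Un; have le_vn : (logn p n <= n.-1)%N.
  by rewrite -ltnS prednK // ltn_logl.
rewrite /log_coef -[n in n%:R](partnC p n_gt0) p_part natrM natrX mulrC.
rewrite [X in _ / _ * X]mulrC mulrA divrK // -mulrA -exprD.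
by rewrite subnK.
Qed.

Definition psi_p u : fps R :=
  xget 0 [set l | padic_lim p
    (fun N => \sum_(1 <= n < N) log_coef n *: (delta_p u / u ^+ p) ^+ n) l]%classic.

(* Bivariate polynomials are elements of {poly {poly R}}: the outer variable  *)
(* is xi_q and the inner one xi_p, so that nu_ij = nu`_j`_i.                  *)
Definition op_p (la : {poly R}) f : fps R :=
  \sum_(i < size la) la`_i *: iter i phi_p f.

Definition op_pq (nu : {poly {poly R}}) f : fps R :=
  \sum_(j < size nu) op_p nu`_j (iter j delta_q f).

Definition psi_m (nu : {poly {poly R}}) (la : {poly R}) u : fps R :=
  op_pq nu (psi_q u) + op_p la (psi_p u).

Definition mu_of (nu : {poly {poly R}}) (la : {poly R}) : {poly {poly R}} :=
  map_poly (fun P => P \Po (p%:R *: 'X)) nu * 'X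
  + ((la \Po (p%:R *: 'X)) * ('X - 1))%:P.

Definition nondegenerate_char nu la := (mu_of nu la).[0].[0] \is a GRing.unit.

Definition char_integer nu la (m : int) := (mu_of nu la).[m%:~R].[0] = 0.

(* The set K_+ (s = false) or K_- (s = true). *)
Definition char_integers nu la : set int :=
  [set m | 0 < (-1) ^+ s * m /\ char_integer nu la m]%classic.

Definition unmixed (k : fieldType) (red : {rmorphism R -> k}) nu la :=
  (forall i j, (i * j != 0)%N -> red (mu_of nu la)`_j`_i = 0) /\
  (exists2 i, i != 0%N & red (mu_of nu la)`_0`_i != 0).

Definition in_U nu la u := u \is a GRing.unit /\ psi_m nu la u = 0.

End Operators.

(* For S a set of positive (s = false) or negative (s = true) integers. *)
Definition short (p : nat) (s : bool) (S : set int) :=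
  exists M m : int,
    [/\ S ((-1) ^+ s * M), S ((-1) ^+ s * m),
        forall x, S x -> m <= (-1) ^+ s * x <= M
      & M%:~R / m%:~R < p%:R / 2 :> rat].

(* The subextension F(a) of emb : F -> Omega is (isomorphic to) a finite      *)
(* Galois extension L of F with abelian Galois group of exponent dividing n.  *)
Definition abelian_killed_by (F Omega : fieldType) (emb : F -> Omega)
    (a : Omega) (n : nat) :=
  exists (L : splittingFieldType F) (i : {rmorphism L -> Omega}) (z : L),
    [/\ forall c, i c%:A = emb c, i z = a, <<1; z>>%VS = fullv,
        galois 1 {:L}
      & abelian 'Gal({:L} / 1)%g /\
        {in 'Gal({:L} / 1)%g, forall g, (g ^+ n)%g = 1%g}].

(* Main.v *)
Require Import Defs.
From HB Require Import structures.
From mathcomp Require Import all_boot all_order all_fingroup all_algebra all_field.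
From mathcomp Require Import boolp classical_sets.
From mathcomp Require Import ring zify.
Import GRing.Theory Num.Theory.
Local Open Scope ring_scope.

Set Implicit Arguments.
Unset Strict Implicit.
Unset Printing Implicit Defensive.

(* Put v = psi_q u. Applying delta_q to psi_m u = 0 and using
   delta_q psi_p u = (phi_p - 1) v gives mu(phi_p, delta_q) v = 0. Comparing
   coefficients, v is supported on the exponents kappa p^j with kappa prime to
   p and bounded, and v_(pn) = phi(v_n) mod p.

   1) Hence a = v mod p satisfies a^p - a = b with b a polynomial: an
   Artin-Schreier equation.

   2) If u is algebraic over K(q), then v = delta_q u / u satisfies a linear
   differential equation over K[q]; since the gaps in the support of v tend to
   infinity, such an equation forces v to be a polynomial. Then so is a, and
   a_(pn) = a_n^p together with a_0 = 0 forces a = 0, so p divides v. As v/p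
   is again a polynomial killed by mu(phi_p, delta_q), v is divisible by all
   powers of p, i.e. v = 0 and u is constant.                                 *)

(** * Formal power series *)

Section FpsBasics.
Variable R : comNzRingType.
Implicit Types f g : fps R.

Lemma fps_coef0 n : (0 : fps R) n = 0.
Proof. by case: n. Qed.

Lemma fps_coef1 n : (1 : fps R) n = (n == 0)%:R.
Proof. by case: n. Qed.

Lemma fps_coefD f g n : (f + g) n = f n + g n.
Proof. by []. Qed.

Lemma fps_coefB f g n : (f - g) n = f n - g n.
Proof. by []. Qed.

Lemma fps_coefM f g n : (f * g) n = \sum_(i < n.+1) f i * g (n - i)%N.
Proof. by []. Qed.

Lemma fps_coefZ c f n : (c *: f) n = c * f n.
Proof. by []. Qed.

Lemma fps_coef_sum I (r : seq I) (P : pred I) (F : I -> fps R) n :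
  (\sum_(i <- r | P i) F i) n = \sum_(i <- r | P i) F i n.
Proof.
by apply: (big_morph (fun f : fps R => f n)) => [f g|] //; exact: fps_coef0.
Qed.

Lemma fps_coef_natM (m n : nat) f : (m%:R * f) n = m%:R * f n.
Proof.
elim: m => [|m IHm]; first by rewrite !mul0r fps_coef0.
by rewrite -natr1 mulrDl mul1r fps_coefD IHm -natr1 mulrDl mul1r.
Qed.

Lemma fps_coef_natXM (m e n : nat) f : (m%:R ^+ e * f) n = m%:R ^+ e * f n.
Proof. by rewrite -!natrX fps_coef_natM. Qed.

Lemma fps_coefX_trunc f m n : (f ^+ m) n = (fps_trunc n f ^+ m)`_n.
Proof.
(* The induction on the exponent uses all lower coefficients of [f ^+ m], hence the claim for every
   [i <= n] at once. *)
suff H i : (i <= n)%N -> (f ^+ m) i = (fps_trunc n f ^+ m)`_i by exact: H.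
elim: m i => [|m IHm] i le_in; first by rewrite !expr0 fps_coef1 coef1.
rewrite !exprS; apply: fps_mul_coefM => j le_ji.
  by rewrite coef_trunc // (leq_trans le_ji).
by rewrite IHm // (leq_trans le_ji).
Qed.

End FpsBasics.

Section MapFps.
Variables (R S : comNzRingType) (h : {rmorphism R -> S}).

Fact map_fps_zmod : zmod_morphism (map_fps h).
Proof. by move=> f g; apply: fpsP => n /=; rewrite rmorphB. Qed.

Fact map_fps_monoid : monoid_morphism (map_fps h).
Proof.
split=> [|f g]; apply: fpsP => n.
  by rewrite -[LHS]/(h ((1 : fps R) n)) !fps_coef1 rmorph_nat.
by rewrite /= rmorph_sum; apply: eq_bigr => i _; rewrite rmorphM.
Qed.

HB.instance Definition _ := GRing.isZmodMorphism.Build (fps R) (fps S)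
  (map_fps h) map_fps_zmod.
HB.instance Definition _ := GRing.isMonoidMorphism.Build (fps R) (fps S)
  (map_fps h) map_fps_monoid.

End MapFps.

(** The coefficient can be computed on a truncation of [f], and on polynomials in characteristic p
    the p-th power is a ring morphism, so it acts term by term. *)
Lemma fps_Frobenius (p : nat) (A : comNzRingType) (f : fps A) n :
  p \in [pchar A] ->
  (f ^+ p) n = if (p %| n)%N then f (n %/ p)%N ^+ p else 0.
Proof.
move=> chA; have p_gt0 := prime_gt0 (pcharf_prime chA).
have chP : p \in [pchar {poly A}] by rewrite pchar_poly.
rewrite fps_coefX_trunc.
have -> : fps_trunc n f ^+ p = (map_poly (pFrobenius_aut chA) (fps_trunc n f)) \Po 'X^p.
  rewrite -(pFrobenius_autE chP) /fps_trunc poly_def !rmorph_sum /=.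
  apply: eq_bigr => i _.
  rewrite pFrobenius_autE map_polyZ map_polyXn comp_polyZ comp_Xn_poly.
  by rewrite exprZn -!exprM mulnC.
rewrite coef_comp_poly_Xn //; case: ifP => // _.
by rewrite coef_map coef_trunc ?leq_div // pFrobenius_autE.
Qed.

(** * The derivation [delta_q] and the Frobenius lift [phi_p] on power series *)

Section DeltaQ.
Variable s : bool.

Section Ring.
Variable R : idomainType.
Implicit Types f g : fps R.
Notation delta := (@delta_q s R).

Lemma delta_qD f g : delta (f + g) = delta f + delta g.
Proof. by apply: fpsP => n; rewrite /= mulrDr. Qed.

Lemma delta_qN f : delta (- f) = - delta f.
Proof. by apply: fpsP => n; rewrite /= mulrN. Qed.

Lemma delta_q0 : delta 0 = 0.
Proof. by apply: fpsP => -[|n]; rewrite /= mulr0. Qed.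

Lemma delta_qZ c f : delta (c *: f) = c *: delta f.
Proof. by apply: fpsP => n; rewrite /= mulrCA. Qed.

(** Leibniz rule: in the i-th term of the convolution the factor n splits as i + (n - i). *)
Lemma delta_qM f g : delta (f * g) = delta f * g + f * delta g.
Proof.
apply: fpsP => n; rewrite fps_coefD -[LHS]/((-1) ^+ s * n%:R * (f * g) n).
rewrite !fps_coefM big_distrr -big_split /=.
apply: eq_bigr => i _ /=.
have le_in : (i <= n)%N by rewrite -ltnS.
rewrite -{1}(subnKC le_in) natrD; ring.
Qed.

Lemma delta_q1 : delta 1 = 0.
Proof.
by apply: fpsP => -[|n]; rewrite /= ?mulr0 ?mul0r.
Qed.

Lemma delta_qX f n : delta (f ^+ n.+1) = n.+1%:R * f ^+ n * delta f.
Proof.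
elim: n => [|n IHn]; first by rewrite !expr1 expr0 !mul1r.
rewrite exprS delta_qM IHn exprS -[n.+2%:R]natr1; ring.
Qed.

Lemma delta_q_nat m : delta m%:R = 0.
Proof. by elim: m => [|m IHm]; rewrite ?delta_q0 // -natr1 delta_qD IHm delta_q1 addr0.
  Qed.

Lemma iter_delta_q_coef j f n :
  iter j delta f n = ((-1) ^+ s * n%:R) ^+ j * f n.
Proof. by elim: j => [|j IHj] /=; rewrite ?expr0 ?mul1r // IHj exprS mulrA. Qed.

End Ring.

Lemma map_delta_q (R S : idomainType) (h : {rmorphism R -> S}) (f : fps R) :
  map_fps h (delta_q s f) = delta_q s (map_fps h f).
Proof.
by apply: fpsP => n; rewrite /= !rmorphM rmorph_nat rmorphXn rmorphN1.
Qed.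

End DeltaQ.

Section PhiP.
Variables (p : nat) (R : idomainType) (phi : {rmorphism R -> R}).
Hypothesis p_gt0 : (0 < p)%N.
Implicit Types f g : fps R.
Notation phip := (phi_p p phi).

Lemma phi_pM f g : phip (f * g) = phip f * phip g.
Proof.
(* On truncations, [phi_p] is a composite of two ring morphisms of polynomials: [phi] on
   coefficients, then the substitution of x^p for x. *)
pose lift n h := map_poly phi (fps_trunc n h) \Po 'X^p.
have liftE n h i : (i <= n)%N -> (lift n h)`_i = phip h i.
  move=> le_in; rewrite coef_comp_poly_Xn //=; case: ifP => // _.
  by rewrite coef_map coef_trunc // (leq_trans (leq_div _ _)).
apply: fpsP => n; rewrite [RHS](@fps_mul_coefM _ _ _ (lift n f) (lift n g)).
- rewrite /lift -comp_polyM -rmorphM coef_comp_poly_Xn //=; case: ifP => // _.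
  rewrite coef_map /=; congr (phi _).
  by rewrite -[LHS]/(fps_mul f g _) (fps_mul_trunc _ _ (leq_div n p)).
- by move=> i le_in; rewrite liftE.
- by move=> i le_in; rewrite liftE.
Qed.

Lemma phi_p1 : phip 1 = 1.
Proof.
apply: fpsP => n; rewrite -[LHS]/(if (p %| n)%N then phi ((1 : fps R) _) else 0).
rewrite !fps_coef1 rmorph_nat; case: ifP => [p_n|].
  by rewrite -[n in RHS](divnK p_n) muln_eq0 (gtn_eqF p_gt0) orbF.
by case: n => [|//]; rewrite dvdn0.
Qed.

Lemma phi_pZnat m f : phip (m%:R *: f) = m%:R *: phip f.
Proof. by apply: fpsP => n /=; case: ifP => _; rewrite ?mulr0 // rmorphM rmorph_nat.
  Qed.

(** This twisted commutation is what turns xi_p into p xi_p in the characteristic polynomial. *)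
Lemma delta_phi_p s f : delta_q s (phip f) = p%:R *: phip (delta_q s f).
Proof.
apply: fpsP => n; rewrite /=; case: ifP => [p_n|_]; last by rewrite !mulr0.
rewrite !rmorphM rmorph_nat rmorphXn rmorphN1 -{1}(divnK p_n) natrM; ring.
Qed.

Lemma iter_phi_p_coef i f n :
  iter i phip f n = if (p ^ i %| n)%N then iter i phi (f (n %/ p ^ i)%N) else 0.
Proof.
elim: i n => [|i IHi] n /=; first by rewrite expn0 dvd1n divn1.
rewrite expnS; case: ifP => [p_n|np_n].
  by rewrite IHi -[n in RHS](divnK p_n) [(_ * p)%N]mulnC dvdn_pmul2l // divnMl //;
     case: ifP; rewrite ?rmorph0.
by case: ifP => // /(dvdn_trans (dvdn_mulr _ (dvdnn p))); rewrite np_n.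
Qed.

Lemma iter_phi_pZnat i m f : iter i phip (m%:R *: f) = m%:R *: iter i phip f.
Proof. by elim: i => //= i ->; rewrite phi_pZnat. Qed.

Lemma delta_iter_phi_p s i f :
  delta_q s (iter i phip f) = p%:R ^+ i *: iter i phip (delta_q s f).
Proof.
elim: i => [|i IHi] /=; first by rewrite expr0 scale1r.
by rewrite delta_phi_p IHi -natrX phi_pZnat scalerA natrX exprS.
Qed.

End PhiP.

(** * Artin-Schreier extensions *)

Section ArtinSchreier.
Variable p : nat.

Lemma pchar_natr_eq (F : fieldType) (chF : p \in [pchar F]) i j :
  (i < p)%N -> (j < p)%N -> i%:R = j%:R :> F -> i = j.
Proof.
wlog le_ij : i j / (i <= j)%N => [th lt_i lt_j eq_ij|lt_i lt_j eq_ij].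
  by case/orP: (leq_total i j) => le_ij; [|symmetry]; apply: th.
have : (j - i)%:R == 0 :> F by rewrite natrB // eq_ij subrr.
rewrite -(dvdn_pcharf chF) => /dvdn_leq; have [|lt_ij] := leqP j i.
  by move=> le_ji _; apply/eqP; rewrite eqn_leq le_ij.
rewrite subn_gt0 lt_ij => /(_ isT) /leq_trans/(_ (leq_subr _ _)).
by rewrite leqNgt lt_j.
Qed.

Lemma size_monic_Artin_Schreier (A : nzRingType) (c : A) : (1 < p)%N ->
  size ('X^p - 'X - c%:P) = p.+1 /\ 'X^p - 'X - c%:P \is monic.
Proof.
move=> p_gt1; have size_low : (size (- 'X - c%:P)%R < size ('X^p : {poly A}))%N.
  by rewrite -opprD size_polyN size_XaddC size_polyXn ltnS.
by rewrite -addrA size_polyDl // monicE lead_coefDl // lead_coefXn size_polyXn.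
Qed.

(** The Frobenius map fixes the prime field, so each w + i is again a root; these are p distinct
    roots of a monic polynomial of degree p. *)
Lemma Artin_Schreier_factor (L : fieldType) (w : L) : p \in [pchar L] ->
  'X^p - 'X - (w ^+ p - w)%:P
    = \prod_(r <- [seq w + i%:R | i <- iota 0 p]) ('X - r%:P) /\
  uniq [seq w + i%:R | i <- iota 0 p].
Proof.
move=> chL; have p_pr := pcharf_prime chL; have p_gt1 := prime_gt1 p_pr.
set rs := map _ _; set T := (X in X = _).
have Urs : uniq rs.
  rewrite map_inj_in_uniq ?iota_uniq // => i j.
  by rewrite !mem_iota /= => lt_i lt_j /addrI/(pchar_natr_eq chL lt_i lt_j).
have [sizeT monT] := size_monic_Artin_Schreier (w ^+ p - w) p_gt1.
split=> //; rewrite (@all_roots_prod_XsubC _ T rs).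
- by rewrite (monicP monT) scale1r.
- by rewrite sizeT size_map size_iota.
- apply/allP => _ /mapP[i _ ->]; rewrite rootE !hornerE.
  have -> : (w + i%:R) ^+ p = w ^+ p + i%:R.
    by rewrite -!(pFrobenius_autE chL) rmorphD rmorph_nat.
  by apply/eqP; ring.
- by rewrite uniq_rootsE.
Qed.

(** Stated for a bare [fieldExtType], because it is also what later endows the extension with its
    [splittingFieldType] structure. *)
Lemma Artin_Schreier_splitting (F : fieldType) (L : fieldExtType F)
    (w : L) (b : F) :
    p \in [pchar F] -> w ^+ p - w = b%:A -> <<1; w>>%VS = fullv ->
  [/\ 'X^p - 'X - b%:A%:P \is a polyOver (1%VS : {vspace L}),
      separable_poly ('X^p - 'X - (b%:A : L)%:P)
    & splittingFieldFor 1 ('X^p - 'X - b%:A%:P) {:L}].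
Proof.
move=> chF wE genL; have chL : p \in [pchar L] by rewrite pchar_lalg.
have p_gt0 := prime_gt0 (pcharf_prime chF).
have [facT Urs] := Artin_Schreier_factor w chL; rewrite wE in facT.
split.
- by rewrite !rpredB ?rpredX ?polyOverX // polyOverC memvZ ?mem1v.
- by rewrite facT separable_prod_XsubC.
- exists [seq w + i%:R | i <- iota 0 p]; first by rewrite facT eqpxx.
  apply: subv_anti; rewrite subvf /=.
  have : (<<1; w>> <= <<1 & [seq (w + i%:R)%R | i <- iota 0 p]>>)%VS.
    apply/FadjoinP; rewrite sub1v seqv_sub_adjoin //.
    by apply/mapP; exists 0%N; rewrite ?mem_iota ?addr0.
  by rewrite genL.
Qed.

(** Here [E] is a variable, so that the dependent type [gal_of E] can be rewritten along the
    equation defining [E]. *)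
Lemma gal_adjoin_eqE (F : fieldType) (L : splittingFieldType F) (w : L)
    (E : {vspace L}) (g h : gal_of E) :
  <<1; w>>%VS = E -> g \in 'Gal(E / 1)%g -> h \in 'Gal(E / 1)%g ->
  g w = h w -> g = h.
Proof.
move=> defE; case: _ / defE g h => g h gG hG eq_gh; apply/eqP.
by rewrite (gal_adjoin_eq gG hG) eq_gh.
Qed.

(** Each automorphism sends w to w + i with i in the prime field and is determined by i. Such
    translations commute, and the p-th power of one moves w by p i = 0. *)
Lemma Artin_Schreier_abelian (F : fieldType) (L : splittingFieldType F)
    (w : L) (b : F) :
    p \in [pchar F] -> w ^+ p - w = b%:A -> <<1; w>>%VS = fullv ->
  galois 1 {:L} /\ abelian 'Gal({:L} / 1)%g /\
    {in 'Gal({:L} / 1)%g, forall g, (g ^+ p)%g = 1%g}.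
Proof.
move=> chF wE genL; have chL : p \in [pchar L] by rewrite pchar_lalg.
have [facT Urs] := Artin_Schreier_factor w chL.
have p_gt0 := prime_gt0 (pcharf_prime chF).
set rs := map _ _ in facT Urs.
have galG : {in 'Gal({:L} / 1)%g, forall g : gal_of {:L}, exists i, g w = w + i%:R}.
  move=> g gG; have : g w \in rs.
    have b1 : b%:A \in (1%VS : {vspace L}) by rewrite memvZ ?mem1v.
    have gwE : g w ^+ p - g w = w ^+ p - w.
      by rewrite -rmorphXn -rmorphB wE; exact: fixed_gal (subvf _) gG b1.
    by rewrite -root_prod_XsubC -facT rootE !hornerE gwE subrr.
  by case/mapP => i _; exists i.
have gal_eq g h : g \in 'Gal({:L} / 1)%g -> h \in 'Gal({:L} / 1)%g ->
    g w = h w -> g = h by exact: gal_adjoin_eqE.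
split; last split.
- by apply/splitting_galoisField; exists ('X^p - 'X - b%:A%:P);
     exact: (Artin_Schreier_splitting chF wE genL).
- apply/centsP => g gG h hG; apply: gal_eq; rewrite ?groupM //.
  have [[i giw] [j hjw]] := (galG g gG, galG h hG).
  rewrite !galM ?memvf // giw hjw !rmorphD !rmorph_nat /= giw hjw.
  by rewrite -!addrA [i%:R + _]addrC.
- move=> g gG; apply: gal_eq; rewrite ?groupX //.
  have [i giw] := galG g gG.
  have -> n : (g ^+ n)%g w = w + (n * i)%:R.
    elim: n => [|n IHn]; first by rewrite expg0 gal_id addr0.
    by rewrite expgS galM ?memvf // giw rmorphD rmorph_nat /= IHn mulSn natrD addrAC
      addrA.
  by rewrite gal_id natrM (pcharf0 chL) mul0r addr0.
Qed.

Lemma Artin_Schreier_abelian_killed_by (F Omega : fieldType)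
    (emb : {rmorphism F -> Omega}) (z : Omega) (b : F) :
  p \in [pchar F] -> z ^+ p - z = emb b -> abelian_killed_by emb z p.
Proof.
move=> chF zE.
have p_gt1 := prime_gt1 (pcharf_prime chF).
(* The polynomial X^p - X - b may be reducible, since z may already lie in F. The field L is
   therefore built from an annihilator [q] of z of least degree, which is irreducible. *)
have exq : exists n, `[< exists q : {poly F},
    [/\ q != 0, root (map_poly emb q) z & size q = n] >].
  exists (size ('X^p - 'X - b%:P)); apply/asboolP; exists ('X^p - 'X - b%:P).
  split=> //; first by rewrite monic_neq0 ?(size_monic_Artin_Schreier b p_gt1).2.
  by rewrite rootE !rmorphB rmorphXn /= map_polyX map_polyC !hornerE zE subrr.
case: (ex_minnP exq) => n /asboolP[q [nz_q qz0 sz_q]] min_n.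
have irr_q : irreducible_poly q.
  apply/(subfx_irreducibleP qz0 nz_q) => r rz0 nz_r.
  by rewrite sz_q; apply: min_n; apply/asboolP; exists r.
pose L : fieldExtType F := SubFieldExtType qz0 irr_q.
pose inj : {rmorphism L -> Omega} := @subfx_inj F Omega emb z q.
pose w : L := subfx_root emb z q.
have injw : inj w = z by exact: subfx_inj_root.
have injA c : inj c%:A = emb c by exact: (subfx_inj_base qz0 nz_q).
have wE : w ^+ p - w = b%:A.
  by apply: (fmorph_inj inj); rewrite rmorphB rmorphXn /= injw injA.
have genL : <<1; w>>%VS = fullv :> {vspace L}.
  apply/eqP; rewrite eqEsubv subvf; apply/subvP => x _.
  have [r ->] := subfxEroot qz0 nz_q x.
  by apply: mempx_Fadjoin; apply/polyOverP => i; rewrite coef_map;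
    exact: memvZ (mem1v _).
have splitL : splitting_field_axiom L.
  by have [? _ ?] := Artin_Schreier_splitting chF wE genL; exists ('X^p - 'X - b%:A%:P).
pose S := FieldExt_isSplittingField.Build F L splitL.
pose LS : splittingFieldType F := HB.pack L S.
have [galL abL] := @Artin_Schreier_abelian F LS w b chF wE genL.
by exists LS, inj, w.
Qed.
End ArtinSchreier.

(** * Logarithmic derivatives of algebraic power series *)

Section CommonDenominator.
Variable A : idomainType.

Lemma frac_common_denom (I : finType) (x : I -> {fraction A}) :
  exists d, d != 0 /\ exists y : I -> A, forall i, d%:F * x i = (y i)%:F.
Proof.
pose den i := \d_(generic_quotient.repr (x i)).
pose num i := \n_(generic_quotient.repr (x i)).
exists (\prod_i den i); split.
  by apply/prodf_neq0 => i _; exact: denom_ratioP.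
exists (fun i => (\prod_(j | j != i) den j) * num i) => i.
rewrite (bigD1 i) //= [x i]frac_repr -/(num i) -/(den i) !rmorphM.
by rewrite mulrAC mulrCA mulfV ?mulr1 1?mulrC // tofrac_eq0 denom_ratioP.
Qed.

(** A non-zero kernel vector exists over the fraction field for rank reasons; clearing denominators
    brings it back to A. *)
Lemma wide_kernel m n (M : 'M[A]_(m, n)) : (n < m)%N ->
  exists2 c : 'rV[A]_m, c != 0 & c *m M = 0.
Proof.
move=> lt_nm; pose MF := map_mx (@FracField.tofrac A) M.
have /rowV0Pn[v /sub_kermxP vM0 nz_v] : kermx MF != 0.
  rewrite -mxrank_eq0 mxrank_ker subn_eq0 -ltnNge.
  exact: leq_ltn_trans (rank_leq_col _) lt_nm.
have [d [nz_d [y yE]]] := frac_common_denom (v 0).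
have mapE : map_mx (@FracField.tofrac A) (\row_i y i) = d%:F *: v.
  by apply/rowP => i; rewrite !mxE yE.
exists (\row_i y i).
  apply: contra_neq nz_v => y0; apply/eqP; move/eqP: mapE.
  by rewrite y0 map_mx0 eq_sym scaler_eq0 tofrac_eq0 (negPf nz_d).
apply/rowP => j; apply/eqP; rewrite -tofrac_eq.
have := congr1 (fun B : 'rV__ => B 0 j) (map_mxM (@FracField.tofrac A) (\row_i y i) M).
by rewrite mxE => ->; rewrite mapE -scalemxAl vM0 scaler0 !mxE rmorph0.
Qed.

Lemma poly_lin_dep n (r : nat -> {poly A}) :
  (forall i, (i <= n)%N -> (size (r i) <= n)%N) ->
  exists c : nat -> A, (exists2 i, (i <= n)%N & c i != 0) /\
    \sum_(i < n.+1) c i *: r i = 0.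
Proof.
move=> sz_r.
have [c nz_c cM] := @wide_kernel n.+1 n (\matrix_(i, j) (r i)`_j) (ltnSn n).
exists (fun i => c 0 (inord i)); split.
  have /rV0Pn[i ci] := nz_c.
  by exists i; rewrite ?inord_val // -ltnS.
apply/polyP => j; rewrite coef_sum coef0.
have [lt_jn|le_nj] := ltnP j n.
  have := congr1 (fun B : 'rV__ => B 0 (Ordinal lt_jn)) cM.
  rewrite !mxE => sum0; rewrite -[RHS]sum0; apply: eq_bigr => i _.
  by rewrite coefZ inord_val mxE.
apply: big1 => i _; rewrite coefZ nth_default ?mulr0 //.
by rewrite (leq_trans (sz_r i _)) // -ltnS.
Qed.

End CommonDenominator.

(** Induction on the degree: if some integer n0 of the given sign is a root, split off its linear
    factor, which does not vanish at any larger n because positive integers are non-zero in A. *)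
Lemma cofinite_roots_eq0 (A : idomainType) (s : bool) (Q : {poly A}) :
    (forall n, (0 < n)%N -> n%:R != 0 :> A) -> Q != 0 ->
  exists B, forall n, (B <= n)%N -> Q.[(-1) ^+ s * n%:R] != 0.
Proof.
move=> char0; have [m] := ubnP (size Q); elim: m Q => // m IHm Q lt_Qm nz_Q.
have [[n0 /eqP Qn0]|noroot] := pselect (exists n, Q.[(-1) ^+ s * n%:R] == 0);
  last first.
  by exists 0%N => n _; apply: contra_notN noroot => Qn; exists n.
have /factor_theorem[Q1 defQ] : root Q ((-1) ^+ s * n0%:R) by apply/eqP.
have nz_Q1 : Q1 != 0 by apply: contra_neq nz_Q => Q10; rewrite defQ Q10 mul0r.
have [|B HB] := IHm Q1 _ nz_Q1.
  by move: lt_Qm; rewrite defQ size_Mmonic ?monicXsubC // size_XsubC addn2.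
exists (maxn B n0.+1) => n; rewrite geq_max => /andP[le_Bn lt_n0n].
rewrite defQ hornerM mulf_neq0 ?HB // !hornerE -mulrBr mulf_neq0 ?signr_eq0 //.
by rewrite -natrB ?char0 ?subn_gt0 // ltnW.
Qed.

(** The gaps between successive exponents in the support tend to infinity. *)
Definition lacunary (A : nmodType) (u : fps A) :=
  forall L, exists N0, forall n m, (N0 <= n)%N -> (n < m <= n + L)%N ->
    u n = 0 \/ u m = 0.

Section Algebraic.
Variables (K : fieldType) (s : bool).
Hypothesis char0 : forall n, (0 < n)%N -> n%:R != 0 :> K.
Implicit Types (u w : fps K) (G H : {poly {poly K}}).

Let delta := @delta_q s K.
Let ev u G : fps K := (map_poly (@poly_fps K) G).[u].

Let evD u G H : ev u (G + H) = ev u G + ev u H.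
Proof. by rewrite /ev rmorphD hornerD. Qed.
Let evB u G H : ev u (G - H) = ev u G - ev u H.
Proof. by rewrite /ev rmorphB hornerE hornerN. Qed.
Let evM u G H : ev u (G * H) = ev u G * ev u H.
Proof. by rewrite /ev rmorphM hornerM. Qed.
Let evX u : ev u 'X = u.
Proof. by rewrite /ev map_polyX hornerX. Qed.
Let evC u c : ev u c%:P = poly_fps c.
Proof. by rewrite /ev map_polyC hornerC. Qed.
Let evXn u G n : ev u (G ^+ n) = ev u G ^+ n.
Proof. by rewrite /ev rmorphXn horner_exp. Qed.

Let evMn u G n : ev u (G *+ n) = ev u G *+ n.
Proof. by rewrite /ev rmorphMn hornerMn. Qed.

Lemma algebraicOver_ratfun u : algebraicOver (@ratfun_fps K) u%:F ->
  exists2 P : {poly {poly K}}, P != 0 & (map_poly (@poly_fps K) P).[u] = 0.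
Proof.
case=> Q nz_Q rootQ; have [d [nz_d [y yE]]] := frac_common_denom (fun i : 'I_(size Q)
  => Q`_i).
pose P := \sum_(i < size Q) y i *: 'X^i.
have mapP : map_poly (@FracField.tofrac _) P = d%:F *: Q.
  rewrite /P rmorph_sum -[Q in RHS]coefK poly_def scaler_sumr.
  apply: eq_bigr => i _; rewrite /= map_polyZ map_polyXn scalerA; congr (_ *: _).
  by rewrite /= yE.
exists P.
  apply: contra_neq nz_Q => P0; apply/eqP; move/eqP: mapP.
  by rewrite P0 rmorph0 eq_sym scaler_eq0 tofrac_eq0 (negPf nz_d).
apply/eqP; rewrite -tofrac_eq0 -horner_map /= -map_poly_comp.
have -> : map_poly (@FracField.tofrac _ \o @poly_fps K) P
    = map_poly (@ratfun_fps K) (map_poly (@FracField.tofrac _) P).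
  by rewrite -map_poly_comp; apply: eq_map_poly => c /=; rewrite ratfun_fpsE.
by rewrite mapP map_polyZ hornerZ (eqP rootQ) mulr0.
Qed.

(** As long as P' also vanishes at u, replace P by P'. The degree drops, and P' is non-zero in
    characteristic 0 because a non-zero constant cannot vanish at u. *)
Lemma separable_relation u (P : {poly {poly K}}) : P != 0 -> ev u P = 0 ->
  exists2 P1, ev u P1 = 0 & ev u P1^`() != 0.
Proof.
have [m] := ubnP (size P); elim: m P => // m IHm P lt_Pm nz_P P0.
have [P'0|?] := eqVneq (ev u P^`()) 0; last by exists P.
apply: (IHm P^`()) => //.
  by rewrite -ltnS (leq_trans _ lt_Pm) // ltnS lt_size_deriv.
have szP : (1 < size P)%N.
  rewrite ltnNge; apply: contra_neqN nz_P => /size1_polyC defP.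
  move: P0; rewrite defP evC => P00.
  have -> : P`_0 = 0 by apply: (@poly_fps_inj K); rewrite P00 rmorph0.
  by rewrite polyC0.
apply: contraTneq szP => P'E; rewrite -leqNgt; apply/leq_sizeP => j j_gt0.
have /eqP := congr1 (fun T : {poly {poly K}} => T`_j.-1) P'E.
rewrite coef_deriv coef0 prednK // -mulr_natr mulf_eq0 => /orP[/eqP //|].
by rewrite -polyC_natr polyC_eq0 (negPf (char0 j_gt0)).
Qed.

(** Chain rule: [H] is obtained from G by applying the derivation to its coefficients, which are
    polynomials in x. *)
Lemma delta_q_eval u G :
  exists H, delta (ev u G) = ev u H + ev u G^`() * delta u.
Proof.
elim/poly_ind: G => [|G c [H defH]].
  by exists 0; rewrite deriv0 /ev !rmorph0 !horner0 mul0r addr0 /delta delta_q0.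
have [c' defc'] : exists c', delta (poly_fps c) = poly_fps c'.
  exists (((-1) ^+ s)%:P * ('X * c^`())); apply: fpsP => -[|n] /=.
    by rewrite coefCM coefXM !mulr0 mul0r.
  by rewrite coefCM coefXM /= coef_deriv -[in RHS]mulr_natl mulrA.
exists (H * 'X + c'%:P); rewrite derivMXaddC !evD !evM !evX !evC.
by rewrite /delta delta_qD delta_qM -/delta defH defc'; ring.
Qed.

(* K[x][u][1/(u P'(u))] is stable under delta.                                *)
Lemma log_derivative_denominators u w (P : {poly {poly K}}) n :
    delta u = w * u -> ev u P = 0 ->
  exists e (H : nat -> {poly {poly K}}), forall i, (i < n)%N ->
    ev u ('X * P^`()) ^+ e * iter i delta w = ev u (H i).
Proof.
move=> duE P0; set S := 'X * P^`().
(* Implicit differentiation: applying [delta] to P(u) = 0 expresses P'(u) [delta u] as a polynomial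
   in u. *)
have [HP defHP] := delta_q_eval u P.
have PdE : ev u P^`() * delta u = - ev u HP.
  by apply/eqP; rewrite -addr_eq0 addrC -defHP P0 /delta delta_q0.
have closed G : exists H, ev u S * delta (ev u G) = ev u H.
  have [HG ->] := delta_q_eval u G.
  exists ('X * (P^`() * HG - G^`() * HP)).
  have evG : ev u P^`() * (ev u G^`() * delta u) = - (ev u G^`() * ev u HP).
    by rewrite mulrCA PdE mulrN.
  by rewrite /S !evM evB !evM -mulrA mulrDr evG.
(* Quotient rule for f = G(u) / S(u)^e; differentiating S^e f and multiplying by S^2 clears all
   denominators, which raises the exponent by 2. *)
have step f e G : ev u S ^+ e * f = ev u G ->
    exists H, ev u S ^+ e.+2 * delta f = ev u H.
  move=> defG; have [[HG defHG] [HS defHS]] := (closed G, closed S).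
  exists (S * HG - (HS * G) *+ e); rewrite evB evMn (evM u S) (evM u HS) -defHG -defHS
    -defG.
  rewrite [delta (_ * f)]delta_qM -/delta; case: e defG => [|e] _.
    by rewrite expr0 [delta 1]delta_q1; ring.
  by rewrite [delta (_ ^+ _)]delta_qX -/delta -mulr_natl !exprS; ring.
elim: n => [|n [e [H eqH]]]; first by exists 0%N, (fun=> 0).
case: n eqH => [|n] eqH.
  (* Base case: u P'(u) w = P'(u) [delta u], which implicit differentiation has just computed. *)
  exists 1%N, (fun=> - HP) => -[|//] _ /=.
  rewrite expr1 evM evX /ev rmorphN hornerN -/(ev _ _) -/(ev _ _) -PdE duE; ring.
have [G defG] := step _ _ _ (eqH n (ltnSn n)).
(* The earlier numerators are multiplied by S^2 to keep a common exponent. *)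
exists e.+2, (fun i => if i == n.+1 then G else S ^+ 2 * H i) => i.
rewrite ltnS leq_eqVlt; case: eqP => [-> _|_ /= lt_in]; first exact: defG.
by rewrite evM evXn -(eqH i lt_in) mulrA -exprD add2n.
Qed.

(** With d the degree of P, the numerators of w and its first d derivatives reduce modulo P to d + 1
    polynomials of degree less than d in u, hence are dependent over K[x]. *)
Lemma log_derivative_D_finite u w : u != 0 -> delta u = w * u ->
    algebraicOver (@ratfun_fps K) u%:F ->
  exists d (c : nat -> {poly K}), (exists2 i, (i <= d)%N & c i != 0) /\
    \sum_(i < d.+1) poly_fps (c i) * iter i delta w = 0.
Proof.
move=> nz_u duE /algebraicOver_ratfun[P0 nz_P0 /(separable_relation nz_P0)[P Pu
  nz_P'u]].
have nz_P : P != 0.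
  by apply: contra_neq nz_P'u => ->; rewrite deriv0 /ev rmorph0 horner0.
have [e [H defH]] := log_derivative_denominators (size P) duE Pu.
pose d := (size P).-1; have sP : size P = d.+1 by rewrite prednK ?size_poly_gt0.
(* Division over K[x] is only pseudo-division, so each remainder carries a power of the leading
   coefficient of P. *)
pose l i := lead_coef P ^+ scalp (H i) P.
have evl i : ev u (H i %% P) = poly_fps (l i) * ev u (H i).
  have := congr1 (ev u) (Pdiv.Idomain.divp_eq (H i) P);
    rewrite evD evM Pu mulr0 add0r => <-.
  by rewrite -mul_polyC evM evC.
have [i le_id|c [[i le_id nz_c] sumc]] := @poly_lin_dep _ d (fun i => H i %% P).
  by rewrite -ltnS -sP ltn_modp.
exists d, (fun i => c i * l i); split.
  by exists i; rewrite // mulf_neq0 // expf_neq0 // lead_coef_eq0.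
have nz_S : ev u ('X * P^`()) ^+ e != 0 by rewrite expf_neq0 // evM evX mulf_neq0.
apply: (mulfI nz_S); rewrite mulr0 mulr_sumr.
have sum0 := congr1 (ev u) sumc; rewrite [RHS]/ev rmorph0 horner0 in sum0.
rewrite -[RHS]sum0 [RHS]/ev rmorph_sum horner_sum; apply: eq_bigr => j _.
rewrite /= map_polyZ hornerZ [(map_poly _ (_ %% _)).[u]]evl -(defH j) ?sP ?ltn_ord //.
by rewrite [poly_fps (c j * l j)]rmorphM /=; ring.
Qed.

(** If w_n is non-zero and n is large, no other exponent within distance D of n lies in the support.
    The coefficient of x^(n + l) in the relation then reads Q(n) w_n = 0 up to the sign of n, and Q
    has only finitely many such roots. *)
Lemma lacunary_D_finite w d (c : nat -> {poly K}) : lacunary w ->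
    (exists2 i, (i <= d)%N & c i != 0) ->
    \sum_(i < d.+1) poly_fps (c i) * iter i delta w = 0 ->
  exists B, forall n, (B <= n)%N -> w n = 0.
Proof.
move=> lac_w [i0 le_i0d nz_c] rel.
pose D := \max_(i < d.+1) size (c i).
have szc (i : 'I_d.+1) j : (D <= j)%N -> (c i)`_j = 0.
  by move=> le_Dj; rewrite nth_default // (leq_trans _ le_Dj) // (leq_bigmax i).
have [N0 lacD] := lac_w D.
(* Taking l to be the degree of a non-zero [c i0] puts its leading coefficient into Q, which is
   therefore non-zero. *)
pose l := (size (c i0)).-1.
pose Q := \poly_(i < d.+1) (c i)`_l.
have nz_Q : Q != 0.
  apply/eqP => /(congr1 (fun T : {poly K} => T`_i0));
    rewrite coef_poly ltnS le_i0d coef0.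
  by apply/eqP; rewrite -lead_coefE lead_coef_eq0.
have [B HB] := cofinite_roots_eq0 s char0 nz_Q.
(* The margin D keeps n + l - j above N0 for every j below D. *)
exists (maxn B (N0 + D)) => n; rewrite geq_max => /andP[le_Bn le_Nn].
apply/eqP; apply: contraTT (HB n le_Bn) => nz_wn; rewrite negbK.
have lt_lN : (l < (n + l).+1)%N by rewrite ltnS leq_addl.
have := congr1 (fun f : fps K => f (n + l)%N) rel.
rewrite fps_coef_sum fps_coef0.
rewrite (eq_bigr (fun i : 'I_d.+1 => (c i)`_l * ((-1) ^+ s * n%:R) ^+ i * w n)).
  rewrite -mulr_suml => /eqP; rewrite mulf_eq0 (negPf nz_wn) orbF.
  by rewrite horner_poly.
move=> i _; rewrite fps_coefM (bigD1 (Ordinal lt_lN)) //= addnK.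
rewrite iter_delta_q_coef mulrA big1 ?addr0 // => j ne_jl.
rewrite iter_delta_q_coef.
have [le_Dj|lt_jD] := leqP D j; first by rewrite szc // mul0r.
have lt_lD : (l < D)%N.
  by rewrite /l; rewrite prednK ?size_poly_gt0 // (leq_bigmax (Ordinal (le_i0d : i0 <
    d.+1)%N)).
suff -> : w (n + l - j)%N = 0 by rewrite !mulr0.
have lt_Nj : (j <= n + l)%N by rewrite -ltnS.
case: (ltngtP j l) => [lt_jl|lt_lj|eq_jl].
- have [| |/eqP|//] := lacD n (n + l - j)%N.
  + by rewrite (leq_trans _ le_Nn) ?leq_addr.
  + by apply/andP; split; lia.
  + by rewrite (negPf nz_wn).
- have [| |//|/eqP] := lacD (n + l - j)%N n.
  + by lia.
  + by apply/andP; split; lia.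
  + by rewrite (negPf nz_wn).
- by case/eqP: ne_jl; apply: val_inj.
Qed.

End Algebraic.

(** * Characters of the multiplicative group *)

Section Pdvd.
Variables (p : nat) (A : comNzRingType).
Implicit Types x y : A.

Lemma pdvd0 n : pdvd p n (0 : A).
Proof. by exists 0; rewrite mulr0. Qed.

Lemma pdvdD n x y : pdvd p n x -> pdvd p n y -> pdvd p n (x + y).
Proof. by move=> [a ->] [b ->]; exists (a + b); rewrite mulrDr. Qed.

Lemma pdvdN n x : pdvd p n x -> pdvd p n (- x).
Proof. by move=> [a ->]; exists (- a); rewrite mulrN. Qed.

Lemma pdvdMl n x y : pdvd p n y -> pdvd p n (x * y).
Proof. by move=> [a ->]; exists (x * a); rewrite mulrCA. Qed.

Lemma pdvdMr n x y : pdvd p n x -> pdvd p n (x * y).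
Proof. by rewrite mulrC; exact: pdvdMl. Qed.

Lemma pdvd_expr n m x : (n <= m)%N -> pdvd p n (p%:R ^+ m * x).
Proof. by move=> le_nm; exists (p%:R ^+ (m - n) * x); rewrite mulrA -exprD subnKC. Qed.

Lemma pdvd_sum n I (r : seq I) (P : pred I) (F : I -> A) :
  (forall i, P i -> pdvd p n (F i)) -> pdvd p n (\sum_(i <- r | P i) F i).
Proof.
by move=> dvF; elim/big_rec: _ => [|i x Pi dvx]; [exact: pdvd0 | apply: pdvdD => //;
  exact: dvF].
Qed.

Lemma fps_pdvdP n (f : fps A) : pdvd p n f <-> forall i, pdvd p n (f i).
Proof.
split=> [[g ->] i|dvf]; first by exists (g i); rewrite fps_coef_natXM.
have /boolp.choice[g fE] : forall i, exists y, f i = p%:R ^+ n * y by exact: dvf.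
by exists (Fps g); apply: fpsP => i; rewrite fps_coef_natXM.
Qed.

Lemma pdvd_tele n (x : nat -> A) :
  (forall i, (n <= i)%N -> pdvd p n (x i.+1 - x i)) ->
  forall i j, (n <= i <= j)%N -> pdvd p n (x j - x i).
Proof.
move=> dvx i j /andP[le_ni le_ij]; rewrite -(telescope_sumr _ le_ij).
rewrite big_nat_cond; apply: pdvd_sum => l; rewrite andbT => /andP[le_il _].
by apply: dvx; rewrite (leq_trans le_ni).
Qed.

End Pdvd.

(** * p-adically complete rings and their residue field *)

Section PadicRing.
Variables (p : nat) (R : idomainType) (k : fieldType) (red : {rmorphism R -> k}).
Hypothesis p_pr : prime p.
Hypothesis separated : forall b : R, (forall n, pdvd p n b) -> b = 0.
Hypothesis complete : forall x : nat -> R,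
  (forall n, pdvd p n (x n.+1 - x n)) -> exists l, padic_lim p x l.
Hypothesis residue : is_residue_field p red.
Hypothesis nz_p : p%:R != 0 :> R.

(** The explicit rate of convergence makes limits of series uniform in the coefficient index, so
    they can be taken coefficientwise. *)
Lemma padic_lim_unif (x : nat -> R) :
    (forall n, pdvd p n (x n.+1 - x n)) ->
  exists l, forall n m, (n <= m)%N -> pdvd p n (x m - l).
Proof.
move=> dvx; have [l lim_l] := complete dvx; exists l => n m le_nm.
have [N HN] := lim_l n; pose M := maxn N m.
(* Compare [x m] with a term [x M] so far out that it is already close to l. *)
have -> : x m - l = - (x M - x m) + (x M - l) by ring.
apply: pdvdD; last by apply: HN; exact: leq_maxl.
apply: pdvdN; apply: pdvd_tele; last by rewrite le_nm leq_maxr.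
move=> i le_ni; have [y ->] := dvx i; exact: pdvd_expr.
Qed.

Lemma fps_separated (f : fps R) : (forall n, pdvd p n f) -> f = 0.
Proof.
move=> dvf; apply: fpsP => i; rewrite fps_coef0; apply: separated => n.
by have /fps_pdvdP := dvf n.
Qed.

Lemma fps_complete (x : nat -> fps R) :
    (forall n, pdvd p n (x n.+1 - x n)) ->
  exists l, forall n m, (n <= m)%N -> pdvd p n (x m - l).
Proof.
move=> dvx.
have /boolp.choice[l Hl] : forall i, exists l, forall n m,
  (n <= m)%N -> pdvd p n (x m i - l).
  move=> i; apply: padic_lim_unif => n.
  by have /fps_pdvdP/(_ i) := dvx n.
by exists (Fps l) => n m le_nm; apply/fps_pdvdP => i; exact: Hl.
Qed.

Lemma red_eq0 x : red x = 0 <-> pdvd p 1 x.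
Proof. exact: residue.2. Qed.

(** If y lifts the inverse of [red x], then 1 - x y is divisible by p, and the geometric series in 1
    - x y, times y, converges to the inverse of x. *)
Lemma unit_red x : (x \is a GRing.unit) = (red x != 0).
Proof.
apply/idP/idP => [/(rmorph_unit red)|nz_x]; first by rewrite unitfE.
have [y red_y] := residue.1 (red x)^-1.
have [z tE] : pdvd p 1 (1 - x * y).
  by apply/red_eq0; rewrite rmorphB rmorph1 rmorphM red_y divff // subrr.
have dvtX n : pdvd p n ((1 - x * y) ^+ n).
  by rewrite tE expr1 exprMn; exists (z ^+ n).
have [l lim_l] := @padic_lim_unif (fun n => \sum_(i < n) (1 - x * y) ^+ i)
  (fun n => ltac:(by rewrite /= big_ord_recr /= addrAC subrr add0r)).
suff xyl : x * (y * l) - 1 = 0.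
  by apply/unitrPr; exists (y * l); apply/eqP; rewrite -subr_eq0 xyl.
apply: separated => n; have := lim_l n n (leqnn n); set S := \sum_(i < n) _.
have SE : (x * y) * S = 1 - (1 - x * y) ^+ n.
  by rewrite -opprB subrX1 -/S; ring.
have -> : x * (y * l) - 1 = - ((x * y) * (S - l)) - (1 - x * y) ^+ n.
  by rewrite mulrBr SE; ring.
by move=> dvS; apply: pdvdD; apply: pdvdN; [apply: pdvdMl | exact: dvtX].
Qed.

Lemma residue_pchar : p \in [pchar k].
Proof.
rewrite inE p_pr /= -(rmorph_nat red); apply/eqP/red_eq0.
by exists 1; rewrite mulr1 expr1.
Qed.

Lemma natr_unit n : (n%:R \is a @GRing.unit R) = ~~ (p %| n)%N.
Proof. by rewrite unit_red rmorph_nat -(dvdn_pcharf residue_pchar). Qed.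

Lemma natr_neq0 n : (0 < n)%N -> n%:R != 0 :> R.
Proof.
move=> n_gt0; have [m cop_pm ->] := pfactor_coprime p_pr n_gt0.
rewrite natrM natrX mulf_neq0 ?expf_neq0 //.
have : m%:R \is a @GRing.unit R by rewrite natr_unit -prime_coprime.
by apply: contraTneq => ->; rewrite unitr0.
Qed.

Section Frobenius.
Variable phi : {rmorphism R -> R}.
Hypothesis phi_red : forall x, red (phi x) = red x ^+ p.
Variable s : bool.
Implicit Types u f : fps R.
Notation phip := (phi_p p phi).
Notation delta := (@delta_q s R).

Let nz_pF : p%:R != 0 :> fps R.
Proof.
apply: contra_neq nz_p => /(congr1 (fun f : fps R => f 0%N)).
by rewrite -[p%:R]mulr1 fps_coef_natM fps_coef1 fps_coef0 mulr1.
Qed.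

(** Modulo p, both [phi_p] and the p-th power act as Frobenius on k[[x]], so the quotient chosen by
    [delta_p] exists. *)
Lemma delta_pE u : p%:R * delta_p p phi u = phip u - u ^+ p.
Proof.
apply: (@xgetPex _ 0 [set v | p%:R * v = phip u - u ^+ p]%classic).
suff [v ->] : pdvd p 1 (phip u - u ^+ p) by exists v; rewrite /= expr1.
apply/fps_pdvdP => i; apply/red_eq0.
have eqF : red ((u ^+ p) i) = (map_fps red u ^+ p) i.
  by rewrite -rmorphXn.
rewrite fps_coefB rmorphB eqF (fps_Frobenius _ _ residue_pchar) /=.
by case: ifP => _; rewrite ?phi_red ?rmorph0 subrr.
Qed.

Lemma log_coef_pdvd m n : (m.*2.+2 <= n)%N -> pdvd p m (log_coef p R n).
Proof.
move=> le_mn; have n_gt0 : (0 < n)%N by apply: leq_trans le_mn.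
(* From 2v <= 2^v <= p^v <= n with v the p-adic valuation of n; thus n - 1 - v >= m as soon as n >=
   2m + 2. *)
have le_vn : ((logn p n).*2 <= n)%N.
  have le_2X v : (v.*2 <= 2 ^ v)%N.
    elim: v => // -[|v] IHv //; rewrite expnS; move: IHv (expn_gt0 2 v.+1) => /=.
    by rewrite -!mul2n; case: (v) => [|w] //; lia.
  apply: leq_trans (le_2X _) (leq_trans _ (dvdn_leq n_gt0 (pfactor_dvdnn p n))).
  by case: (logn p n) => [|v]; rewrite ?expn0 // leq_exp2r ?prime_gt1.
rewrite /log_coef mulrAC mulrC; apply: pdvd_expr.
move: le_mn le_vn; rewrite -!muln2; lia.
Qed.

(** The logarithm series converges, so [psi_p] is a genuine limit and not the default value of
    [xget]. *)
Lemma psi_p_lim u :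
  padic_lim p (fun N => \sum_(1 <= n < N) log_coef p R n *: (delta_p p phi u / u ^+ p)
    ^+ n)
    (psi_p p phi u).
Proof.
rewrite /psi_p; set T := fun N => _.
apply: (@xgetPex _ 0 [set l | padic_lim p T l]%classic).
have dvT m n : (m.*2.+2 <= n)%N -> pdvd p m (T n.+1 - T n).
  move=> le_mn; rewrite /T big_nat_recr ?(leq_trans _ le_mn) //= addrAC subrr add0r.
  by apply/fps_pdvdP => i; rewrite fps_coefZ; apply/pdvdMr/log_coef_pdvd.
have dvT2 m i j : (m.*2.+2 <= i <= j)%N -> pdvd p m (T j - T i).
  move=> /andP[le_mi le_ij]; rewrite -(telescope_sumr _ le_ij).
  rewrite big_nat_cond; apply: pdvd_sum => l; rewrite andbT => /andP[le_il _].
  by apply: dvT; apply: leq_trans le_il.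
(* The subsequence at 2n + 2 has exactly the rate of convergence that [fps_complete] requires. *)
have [|l Hl] := @fps_complete (fun n => T n.*2.+2).
  by move=> n; apply: dvT2; rewrite leqnn /=; lia.
exists l => n; exists n.*2.+2 => m le_nm.
rewrite -[T m](subrK (T n.*2.+2)) -addrA; apply: pdvdD; last exact: Hl.
by apply: dvT2; rewrite leqnn.
Qed.

Lemma delta_pdvd n f : pdvd p n f -> pdvd p n (delta f).
Proof. by move=> /fps_pdvdP dvf; apply/fps_pdvdP => i; apply/pdvdMl/dvf. Qed.

(* delta psi_p u = delta log (1 + p y) / p, differentiated termwise. *)
Lemma delta_psi_p_log u (y := delta_p p phi u / u ^+ p) :
  (1 + p%:R * y) * delta (psi_p p phi u) = delta y.
Proof.
apply/eqP; rewrite -subr_eq0; apply/eqP; apply: fps_separated => n.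
have [N /(_ (maxn N n).+1)] := psi_p_lim u n; rewrite -/y.
(* Being at least N makes the partial sum close to the limit; being at least n makes the remainder
   (-p y)^m divisible by p^n. *)
set m := maxn N n; set T := \sum_(1 <= i < m.+1) _ => dvT.
have {}dvT : pdvd p n (T - psi_p p phi u) by apply: dvT; rewrite leqW ?leq_maxl.
clearbody y; have deltaT : delta T = (\sum_(i < m) (- (p%:R * y)) ^+ i) * delta y.
  rewrite /T big_add1 /= big_mkord.
  rewrite (big_morph _ (@delta_qD s R) (@delta_q0 s R)) mulr_suml.
  apply: eq_bigr => i _; rewrite delta_qZ delta_qX.
  have := @log_coefE p R i.+1 p_pr isT; rewrite natr_unit.
  have -> : ~~ (p %| (i.+1)`_p^')%N.
    by rewrite -p'natE // part_pnat.
  move=> /(_ isT) cE; rewrite -mulrA mulr_natl -scaler_nat scalerA [_ * i.+1%:R]mulrC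
    cE /=.
  rewrite -(natrX R p i) -scalerA scaler_nat [in RHS]exprNn exprMn -(natrX _ p i)
    -!mulrA mulr_natl.
  by rewrite -signr_odd scaler_sign -[in RHS]signr_odd mulr_sign.
have SE : (1 + p%:R * y) * \sum_(i < m) (- (p%:R * y)) ^+ i = 1 - (- (p%:R * y)) ^+ m.
  by rewrite -[RHS]opprB subrX1; ring.
have -> : (1 + p%:R * y) * delta (psi_p p phi u) - delta y =
    - ((1 + p%:R * y) * delta (T - psi_p p phi u)) - (- (p%:R * y)) ^+ m * delta y.
  by rewrite delta_qD delta_qN mulrBr deltaT mulrA SE; ring.
apply: pdvdD; apply: pdvdN; first by apply/pdvdMl/delta_pdvd.
apply: pdvdMr; rewrite -mulrN exprMn; apply: pdvd_expr; exact: leq_maxr.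
Qed.

(** Take logarithmic derivatives in phi_p(u) = u^p (1 + p y): the left side gives p phi_p(v), the
    right side p v + p delta(psi_p u). Then cancel p. *)
Lemma delta_psi_p u : u \is a GRing.unit ->
  delta (psi_p p phi u) = phip (psi_q s u) - psi_q s u.
Proof.
move=> Uu; have p_gt0 := prime_gt0 p_pr.
set v := psi_q s u; have vE : delta u = v * u by rewrite divrK.
set y := delta_p p phi u / u ^+ p.
have phiE : phip u = u ^+ p * (1 + p%:R * y).
  by rewrite mulrDr mulr1 mulrCA [u ^+ p * y]mulrC divrK ?unitrX // delta_pE subrKC.
have nz_phiu : phip u != 0.
  apply/eqP => phiu0; have /eqP := oner_eq0 (fps R); apply.
  by rewrite -(phi_p1 phi p_gt0) -(divrr Uu) phi_pM // phiu0 mul0r.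
have uXE : delta (u ^+ p) = p%:R * (u ^+ p * v).
  have uX : u ^+ p = u * u ^+ p.-1 by rewrite -exprS prednK.
  by rewrite -{1}(prednK p_gt0) delta_qX prednK // vE [in RHS]uX; ring.
have wE : delta (1 + p%:R * y) = p%:R * ((1 + p%:R * y) * delta (psi_p p phi u)).
  by rewrite delta_qD delta_q1 add0r delta_qM delta_q_nat mul0r add0r delta_psi_p_log.
have := congr1 delta phiE; rewrite delta_phi_p // vE phi_pM // delta_qM uXE wE.
rewrite scaler_nat => E.
apply: (mulfI nz_phiu); apply: (mulfI nz_pF); rewrite mulrBr [phip u * phip v]mulrC.
by rewrite mulrBr [_ * (phip v * _)]mulr_natl E phiE; ring.
Qed.

(** * Solutions of the characteristic equation *)

Section CharEquation.
Variables (nu : {poly {poly R}}) (la : {poly R}).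
Hypothesis nondeg : nondegenerate_char p nu la.

Lemma op_pE0 (P : {poly R}) f N :
    (forall i, (0 < i)%N -> iter i phip f N = 0) ->
  op_p p phi P f N = P`_0 * f N.
Proof.
move=> f0; rewrite /op_p fps_coef_sum.
case sP: (size P) => [|d].
  by rewrite big_ord0 nth_default ?sP // mul0r.
rewrite big_ord_recl /= big1 ?addr0 // => i _.
by have /= -> := f0 i.+1 isT; rewrite mulr0.
Qed.

Lemma op_pZnat (P : {poly R}) m f :
  op_p p phi P (m%:R *: f) = m%:R *: op_p p phi P f.
Proof.
rewrite /op_p scaler_sumr; apply: eq_bigr => i _.
by rewrite iter_phi_pZnat ?prime_gt0 // !scalerA mulrC.
Qed.

Lemma iter_delta_qZ j c f : iter j delta (c *: f) = c *: iter j delta f.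
Proof. by elim: j => //= j ->; rewrite delta_qZ. Qed.

(* The operator nu(p phi_p, delta) delta + la(p phi_p) (phi_p - 1) attached to
   the characteristic polynomial; it kills psi_q u.                           *)
Definition char_op f : fps R :=
  delta (op_pq p s phi nu f) + op_p p phi (la \Po (p%:R *: 'X)) (phip f - f).

(** This is mu(0, xi_q), whose integer roots are the characteristic integers. *)
Definition char_poly0 : {poly R} := \poly_(j < size nu) nu`_j`_0 * 'X - (la`_0)%:P.

Lemma comp_pX_coef i : (la \Po (p%:R *: 'X))`_i = p%:R ^+ i * la`_i.
Proof.
rewrite comp_polyE coef_sum.
under eq_bigr => j _ do rewrite exprZn scalerA coefZ coefXn mulr_natr mulrb.
have [lt_i|le_i] := ltnP i (size la).
  rewrite (bigD1 (Ordinal lt_i)) //= eqxx big1 ?addr0 1?mulrC // => j ne_ji.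
  by case: eqP => // eq_ij; case/eqP: ne_ji; apply: val_inj.
rewrite nth_default // mulr0; apply: big1 => j _.
by case: eqP => // eq_ij; move: (ltn_ord j); rewrite -eq_ij ltnNge le_i.
Qed.

Lemma delta_op_p f : delta (op_p p phi la f) = op_p p phi (la \Po (p%:R *: 'X)) (delta
  f).
Proof.
have p_gt0 := prime_gt0 p_pr; rewrite /op_p.
(* As p is non-zero, the substitution preserves the degree, and both sums have the same range. *)
have -> : size (la \Po (p%:R *: 'X)) = size la.
  by rewrite size_comp_poly2 // size_scale ?size_polyX.
rewrite (big_morph _ (@delta_qD s R) (@delta_q0 s R)); apply: eq_bigr => i _.
by rewrite delta_qZ delta_iter_phi_p // comp_pX_coef scalerA mulrC.
Qed.

Lemma char_op_psi_q u : u \is a GRing.unit -> psi_m p s phi nu la u = 0 ->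
  char_op (psi_q s u) = 0.
Proof.
move=> Uu psi0; rewrite /char_op -delta_psi_p // -delta_op_p -delta_qD.
by rewrite -/(psi_m p s phi nu la u) psi0 delta_q0.
Qed.

(** This lets a solution divisible by p be divided by p. *)
Lemma char_opZ f : char_op (p%:R *: f) = p%:R *: char_op f.
Proof.
rewrite /char_op phi_pZnat ?prime_gt0 // -scalerBr op_pZnat scalerDr; congr (_ + _).
rewrite -delta_qZ /op_pq scaler_sumr; congr (delta _).
by apply: eq_bigr => j _; rewrite iter_delta_qZ op_pZnat.
Qed.

(** The coefficient at N of phi_p^i g involves only g at N / p^i, so under the hypothesis only the
    terms free of phi_p survive, and these add up to mu(0, N), with the sign carried by [s]. *)
Lemma char_op_coef f N :
    (forall i, (0 < i)%N -> (p ^ i %| N)%N -> f (N %/ p ^ i)%N = 0) ->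
  char_op f N = char_poly0.[(-1) ^+ s * N%:R] * f N.
Proof.
have p_gt0 := prime_gt0 p_pr; move=> f0.
have phi0 i : (0 < i)%N -> iter i phip f N = 0.
  by move=> i_gt0; rewrite iter_phi_p_coef //; case: ifP => // pi_N;
    rewrite f0 // iter_fix ?rmorph0.
rewrite /char_op fps_coefD (@op_pE0 _ (phip f - f)); last first.
  (* The coefficient at N of phi_p^i (phi_p f - f) involves f at N / p^i and N / p^(i+1), both
     zero. *)
  move=> i i_gt0; rewrite iter_phi_p_coef //; case: ifP => // pi_N.
  have := phi0 i.+1 isT; rewrite iter_phi_p_coef // expnSr => phi0i.
  rewrite [(phip f - f) _]fps_coefB f0 // subr0 /=.
  case: ifP => [p_Ni|_]; last by rewrite iter_fix ?rmorph0.
  rewrite -divnMA; move: phi0i; rewrite -iterSr.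
  by rewrite -[N in (_ %| N)%N](divnK pi_N) [(p ^ i * p)%N]mulnC dvdn_pmul2r ?expn_gt0
    ?p_gt0 // p_Ni -mulnC.
have -> : (phip f - f) N = - f N by rewrite fps_coefB (phi0 1%N) ?sub0r.
rewrite comp_pX_coef expr0 mul1r /= /op_pq fps_coef_sum.
under eq_bigr => j _.
  rewrite op_pE0 => [|i i_gt0]; last first.
    rewrite iter_phi_p_coef //; case: ifP => // pi_N.
    by rewrite iter_delta_q_coef f0 // mulr0 iter_fix ?rmorph0.
  rewrite iter_delta_q_coef mulrA.
  over.
by rewrite -mulr_suml /char_poly0 hornerD hornerN hornerMX hornerC horner_poly; ring.
Qed.

Lemma la0_unit : la`_0 \is a GRing.unit.
Proof.
move: nondeg; rewrite /nondegenerate_char /mu_of !hornerE.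
by rewrite horner_comp !hornerE horner_coef0 mulrN1 unitrN.
Qed.

Lemma char_poly0_neq0 : char_poly0 != 0.
Proof.
apply/eqP => /(congr1 (fun P : {poly R} => P`_0)).
rewrite coefB coefMX coefC coef0 sub0r /= => /eqP; rewrite oppr_eq0 => /eqP la0.
by move: la0_unit; rewrite la0 unitr0.
Qed.

(** Modulo p the value is -la(0), a unit by non-degeneracy. *)
Lemma char_poly0_pdvd N : (p %| N)%N -> char_poly0.[(-1) ^+ s * N%:R] != 0.
Proof.
move=> p_N; suff : char_poly0.[(-1) ^+ s * N%:R] \is a GRing.unit.
  by apply: contraTneq => ->; rewrite unitr0.
rewrite unit_red /char_poly0 hornerD hornerN hornerMX hornerC rmorphB !rmorphM
  rmorph_nat.
have -> : N%:R = 0 :> k by apply/eqP; rewrite -(dvdn_pcharf residue_pchar).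
by rewrite !mulr0 sub0r oppr_eq0 -unit_red la0_unit.
Qed.

(** At an exponent divisible by p, the outer derivation contributes a factor N = 0 in k, and every
    positive power of p phi_p dies modulo p. Only la(0) (phi_p - 1) f is left, with la(0) a unit. *)
Lemma char_op0_red f N : char_op f = 0 -> (p %| N)%N ->
  red (f N) = red (f (N %/ p)%N) ^+ p.
Proof.
have p_gt0 := prime_gt0 p_pr; move=> Mf0 p_N.
have redp0 : red p%:R = 0 by rewrite rmorph_nat (pcharf0 residue_pchar).
have redN0 : red N%:R = 0.
  by rewrite rmorph_nat; apply/eqP; rewrite -(dvdn_pcharf residue_pchar).
have := congr1 (fun g : fps R => red (g N)) Mf0.
rewrite fps_coef0 rmorph0 /char_op fps_coefD /= rmorphD !rmorphM redN0 mulr0 mul0r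
  add0r.
rewrite /op_p fps_coef_sum rmorph_sum /=.
case sP: (size _) => [|d].
  move: sP => /eqP; rewrite size_poly_eq0 => /eqP/(congr1 (fun P : {poly R} => P`_0)).
  rewrite comp_pX_coef expr0 mul1r coef0 => la0.
  by move: la0_unit; rewrite la0 unitr0.
rewrite big_ord_recl /= big1 => [|i _]; last first.
  by rewrite comp_pX_coef !rmorphM rmorphXn redp0 expr0n !mul0r.
rewrite addr0 comp_pX_coef expr0 mul1r p_N rmorphM rmorphB phi_red.
move/eqP; rewrite mulf_eq0 -[_ == 0]negbK -unit_red la0_unit /= subr_eq0.
by move/eqP => ->.
Qed.

(** Strong induction on j: once f vanishes at m p^i for all i < j, the equation at N = m p^j is
    mu(0, N) f_N = 0 up to the sign of N. The factor is non-zero by the choice of B if j = 0, and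
    because p divides N otherwise. *)
Lemma char_op0_support f B :
    (forall n, (B <= n)%N -> char_poly0.[(-1) ^+ s * n%:R] != 0) ->
    char_op f = 0 ->
  forall j m, coprime p m -> (B <= m)%N -> f (m * p ^ j)%N = 0.
Proof.
have p_gt1 := prime_gt1 p_pr; have p_gt0 := prime_gt0 p_pr.
move=> HB Mf0 j m cop_pm le_Bm; elim/ltn_ind: j => j IHj.
have /char_op_coef : forall i, (0 < i)%N -> (p ^ i %| m * p ^ j)%N -> f (m * p ^ j %/ p
  ^ i)%N = 0.
  move=> i i_gt0; rewrite Gauss_dvdr ?coprimeXl // dvdn_Pexp2l // => le_ij.
  by rewrite -(subnK le_ij) expnD mulnA mulnK ?expn_gt0 ?p_gt0 // IHj // ltn_subrL
    i_gt0 (leq_trans i_gt0).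
rewrite Mf0 fps_coef0 => /esym/eqP; rewrite mulf_eq0 => /orP[|/eqP //].
case: j {IHj} => [|j]; first by rewrite muln1 (negPf (HB m le_Bm)).
by rewrite (negPf (char_poly0_pdvd _)) // expnS mulnCA dvdn_mulr.
Qed.

(** An exponent in the support is m p^j with m prime to p and bounded, so a large exponent forces a
    large j. *)
Lemma char_op0_dvd f : char_op f = 0 ->
  exists B, forall L n, (B * p ^ L <= n)%N -> f n != 0 -> (p ^ L %| n)%N.
Proof.
have p_gt0 := prime_gt0 p_pr.
move=> Mf0; have [B HB] := cofinite_roots_eq0 s natr_neq0 char_poly0_neq0.
exists B.+1 => L n le_n nz_fn.
have n_gt0 : (0 < n)%N by apply: leq_trans le_n; rewrite muln_gt0 expn_gt0 p_gt0.
have [m cop_pm defn] := pfactor_coprime p_pr n_gt0.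
rewrite defn; apply/dvdn_mull/dvdn_exp2l; rewrite leqNgt.
apply: contra nz_fn => lt_jL; rewrite defn (char_op0_support HB Mf0) //.
rewrite leqNgt; apply/negP => lt_mB.
move: le_n; rewrite leqNgt {1}defn => /negP; apply.
rewrite (leq_ltn_trans (leq_mul (ltnW lt_mB) (leq_pexp2l p_gt0 (ltnW lt_jL)))) //.
by rewrite ltn_pmul2r ?expn_gt0 ?p_gt0.
Qed.

(** Two distinct large exponents of the support are both divisible by p^L, hence differ by at least
    p^L > L. *)
Lemma char_op0_lacunary f : char_op f = 0 -> lacunary f.
Proof.
move=> /char_op0_dvd[B HB] L; exists (B * p ^ L)%N => n m le_n /andP[lt_nm le_mn].
have [->|nz_fn] := eqVneq (f n) 0; first by left.
have [->|nz_fm] := eqVneq (f m) 0; first by right.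
have := dvdn_sub (HB L m (leq_trans le_n (ltnW lt_nm)) nz_fm) (HB L n le_n nz_fn).
move=> /dvdn_leq; rewrite subn_gt0 => /(_ lt_nm); rewrite leqNgt => /negP[].
by apply: leq_ltn_trans (ltn_expl L (prime_gt1 p_pr)); rewrite leq_subLR.
Qed.

(** Induction on n over all solutions: p divides f, and f / p satisfies the same hypotheses. The
    condition at 0 excludes the constants fixed by [phi], which are solutions too. *)
Lemma char_op0_finite f B : char_op f = 0 -> f 0%N = 0 ->
  (forall n, (B <= n)%N -> f n = 0) -> f = 0.
Proof.
have p_gt1 := prime_gt1 p_pr; have p_gt0 := prime_gt0 p_pr.
move=> Mf0 f00 finf; apply: fps_separated => n.
elim: n f Mf0 f00 finf => [|n IHn] f Mf0 f00 finf; first by exists f;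
  rewrite expr0 mul1r.
have dv1 N : red (f N) = 0.
  have [->|N_gt0] := posnP N; first by rewrite f00 rmorph0.
  have redX j : red (f (N * p ^ j)%N) = red (f N) ^+ (p ^ j).
    elim: j => [|j IHj]; first by rewrite muln1 expr1.
    rewrite (char_op0_red Mf0); last by rewrite expnS mulnCA dvdn_mulr.
    by rewrite expnSr mulnA mulnK // IHj -exprM.
  (* The exponent N p^B exceeds B, where f vanishes; so a power of [red (f N)] is zero. *)
  have := redX B; rewrite finf ?rmorph0; last first.
    by rewrite (leq_trans (ltnW (ltn_expl B p_gt1))) // leq_pmull.
  by move/esym/eqP; rewrite expf_eq0 => /andP[_ /eqP].
have [g defg] : pdvd p 1 f by apply/fps_pdvdP => N; apply/red_eq0.
have fE : f = p%:R *: g by rewrite defg expr1 scaler_nat mulr_natl.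
have gE N : f N = 0 -> g N = 0.
  by rewrite fE => /eqP; rewrite mulf_eq0 (negPf nz_p) => /eqP.
have [|||h defh] := IHn g.
- apply: fpsP => N; apply: (mulfI nz_p).
  by rewrite -[LHS]/((p%:R *: char_op g) N) -char_opZ -fE Mf0 fps_coef0 mulr0.
- exact: gE.
- by move=> N le_BN; apply/gE/finf.
by exists h; rewrite defg defh expr1 exprS mulrA.
Qed.

(** At exponents divisible by p the coefficients of a^p and a agree by [char_op0_red]; at the others
    a^p has none, and those of a vanish beyond B. *)
Lemma char_op0_Artin_Schreier f : char_op f = 0 ->
  exists b : {poly k}, map_fps red f ^+ p - map_fps red f = poly_fps b.
Proof.
move=> Mf0; have [B HB] := cofinite_roots_eq0 s natr_neq0 char_poly0_neq0.
exists (\poly_(n < B) if (p %| n)%N then 0 else - red (f n)); apply: fpsP => n.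
rewrite fps_coefB (fps_Frobenius _ _ residue_pchar) /= coef_poly.
case: ifP => [p_n|np_n]; first by rewrite (char_op0_red Mf0 p_n) subrr if_same.
rewrite sub0r; case: ltnP => // le_Bn.
have := char_op0_support HB Mf0 0 _ le_Bn; rewrite muln1 prime_coprime // np_n.
by move=> ->; rewrite // rmorph0 oppr0.
Qed.

End CharEquation.

Lemma psi_q0 u : psi_q s u 0%N = 0.
Proof. by rewrite /psi_q fps_coefM big_ord1 /= mulr0 !mul0r. Qed.

Lemma psi_q_eq0 u : u \is a GRing.unit -> psi_q s u = 0 -> u = fpsC (u 0%N).
Proof.
move=> Uu v0; have du0 : delta u = 0 by rewrite -(divrK Uu (delta u)) [_ / _]v0 mul0r.
apply: fpsP => -[|n] //=; apply/eqP.
have := congr1 (fun g : fps R => g n.+1) du0; rewrite fps_coef0 /= => /eqP.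
by rewrite !mulf_eq0 signr_eq0 (negPf (natr_neq0 _)).
Qed.

End Frobenius.
End PadicRing.

Theorem corollary7p11 (p : nat) (R : idomainType) (k K : fieldType)
    (red : {rmorphism R -> k}) (iota : {rmorphism R -> K})
    (phi : {rmorphism R -> R}) (s : bool)
    (nu : {poly {poly R}}) (la : {poly R}) (u : fps R) :
  prime p -> p <> 2%N ->
  is_completed_max_unramified p R ->
  is_residue_field p red ->
  is_localization_at_p p iota ->
  is_frobenius_lift p red phi ->
  nondegenerate_char p nu la ->
  in_U p s phi nu la u ->
  let a : fps k := map_fps red (psi_q s u) in
  (integralOver (@poly_fps k) a /\
   abelian_killed_by (@ratfun_fps k) a%:F p) /\
  (unmixed p red nu la ->
   short p s (char_integers p s nu la) ->
   (forall c : R, u <> fpsC c) ->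
   ~ algebraicOver (@ratfun_fps K) (map_fps iota u)%:F).
Proof.
move=> p_pr _ [Zp [O [j [i [_ _ [sepR complR _ _]]]]]] resR [iota_inj nz_pK _].
move=> [_ phi_red] nondeg [Uu psi0]; set v := psi_q s u => a.
have nz_p : p%:R != 0 :> R.
  by apply: contra_neq nz_pK => p0; rewrite -(rmorph_nat iota) p0 rmorph0.
have Mv0 := char_op_psi_q p_pr sepR complR resR nz_p phi_red Uu psi0.
have v0 := psi_q0 s u; rewrite -/v in Mv0 v0.
have chk := residue_pchar p_pr resR.
split.
  have [b ab] := char_op0_Artin_Schreier p_pr sepR complR resR nz_p phi_red nondeg Mv0.
  split.
    (* The Artin-Schreier polynomial is monic over k[x], which gives integrality. *)
    exists ('X^p - 'X - b%:P).
      exact: (size_monic_Artin_Schreier b (prime_gt1 p_pr)).2.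
    by rewrite rootE !rmorphB rmorphXn /= map_polyX map_polyC !hornerE ab subrr.
  apply: (@Artin_Schreier_abelian_killed_by _ _ _ _ _ b%:F).
    by apply: (rmorph_pchar (@FracField.tofrac _)); rewrite pchar_poly.
  by rewrite /= ratfun_fpsE -ab rmorphB rmorphXn.
move=> _ _ nonconst alg_u.
have char0K n : (0 < n)%N -> n%:R != 0 :> K.
  move=> n_gt0; rewrite -(rmorph_nat iota) raddf_eq0 //.
  exact: (natr_neq0 p_pr sepR complR resR nz_p).
have lacw : lacunary (map_fps iota v).
  move=> L; have [N0 HN0] := char_op0_lacunary p_pr sepR complR resR nz_p nondeg Mv0 L.
  exists N0 => n m le_n lt_nm; have [fn0|fm0] := HN0 n m le_n lt_nm.
    by left; rewrite -[LHS]/(iota (v n)) fn0 rmorph0.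
  by right; rewrite -[LHS]/(iota (v m)) fm0 rmorph0.
have nz_u : map_fps iota u != 0.
  apply: contraTneq Uu => iu0; suff -> : u = 0 by rewrite unitr0.
  apply: fpsP => n; apply: iota_inj.
  by have := congr1 (fun f : fps K => f n) iu0; rewrite !fps_coef0 rmorph0.
have duE : delta_q s (map_fps iota u) = map_fps iota v * map_fps iota u.
  by rewrite -map_delta_q -rmorphM divrK.
have [d [c [nz_c rel]]] := log_derivative_D_finite char0K nz_u duE alg_u.
have [B HB] := lacunary_D_finite char0K lacw nz_c rel.
(* Injectivity of [iota] brings the vanishing back from K to R, where repeated division by p
   applies. *)
have finv n : (B <= n)%N -> v n = 0.
  by move=> /HB; rewrite -[LHS]/(iota (v n)) => iv0; apply: iota_inj;
    rewrite iv0 rmorph0.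
have v00 := char_op0_finite p_pr sepR complR resR nz_p phi_red nondeg Mv0 v0 finv.
exact: nonconst (psi_q_eq0 p_pr sepR complR resR nz_p Uu v00).
Qed.
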